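(* Assume that: (a) for all $x\in\mathbb{T}$ and $l\in\{2,3\}$, $|x-B_1|<|x-B_l|$ implies $c_1(x)<c_l(x)$; (b) $c(B_1)<c(x)<c(0)$ for any $x\in\mathbb{T}_1\setminus\{0,B_1\}$; (c) $c$ is continuous at $0$ and at $B_1$. Let $\gamma=\int_{\mathbb{T}_1}c(x)\,dx$. Then $\Lambda^*$ and $\overline\Lambda{}^*$ are continuous on $(c(B_1),c(0))$, and: (i) $$\Lambda^*(y)=\begin{cases} y\theta_y-\Lambda(\theta_y), & \text{if } c(B_1)<y<c(0),\\ +\infty, & \text{if } c(B_1)>y\text{ or }y>c(0),\end{cases}$$ where $\theta_y$ is the unique solution $\theta\in\mathbb{R}$ of $$\frac{\int_{\mathbb{T}_1}c(x)e^{\theta c(x)}\,dx}{\int_{\mathbb{T}_1}e^{\theta c(x)}\,dx}=y .$$ (ii) $$\overline\Lambda{}^*(y)=\begin{cases} y\eta_y-\overline\Lambda(\eta_y), & \text{if } c(B_1)<y<c(0),\\ +\infty, & \text{if } c(B_1)>y\text{ or }y>c(0),\end{cases}$$ where $\eta_y$ is the unique solution $\theta\in\mathbb{R}$ of $$\frac{\int_{\mathbb{T}_1}c(x)e^{\theta c(x)}\,dx}{\int_{\mathbb{T}_1}e^{\theta c(x)}\,dx+2/3}=y .$$ (iii) If $\gamma<y<c(0)/3$, then $\overline\Lambda{}^*(y)<\Lambda^*(3y)$.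
   Context: Identify the plane with $\mathbb{C}$. Set $\lambda=2(3\sqrt3)^{-1/2}$, $i=\sqrt{-1}$, $j=e^{2i\pi/3}$, $B_2=\lambda i$, $B_1=j^2B_2$, $B_3=jB_2$, and let $\mathbb{T}\subset\mathbb{C}$ be the equilateral triangle with vertices $B_1,B_2,B_3$; it has unit area. $|\cdot|$ is the Euclidean norm, $dx$ is Lebesgue measure. Let $D_1=\{ijt: t<0\}$ and, for $l=2,3$, $D_l=\{ij^lt: t\le 0\}$; the cells $\mathbb{T}_l=\{x\in\mathbb{T}: |x-B_l|=\min_{1\le m\le 3}|x-B_m|\}\setminus D_l$, $l=1,2,3$, form a partition of $\mathbb{T}$, and $0\in\mathbb{T}_1$. The cost function $c:\mathbb{T}\to[0,\infty)$ is measurable with $\|c\|_\infty=\sup_{x\in\mathbb{T}}c(x)<\infty$; put $c_1(x)=c(x)$, $c_2(x)=c(j^2x)$, $c_3(x)=c(jx)$. For $\theta\in\mathbb{R}$ set $\Lambda(\theta)=\log\left(3\int_{\mathbb{T}_1}e^{\theta c(x)}\,dx\right)$ and $\overline\Lambda(\theta)=\log\left(\int_{\mathbb{T}_1}e^{\theta c(x)}\,dx+2/3\right)$; for $y\in\mathbb{R}$ set $\Lambda^*(y)=\sup_{\theta\in\mathbb{R}}(\theta y-\Lambda(\theta))$ and $\overline\Lambda{}^*(y)=\sup_{\theta\in\mathbb{R}}(\theta y-\overline\Lambda(\theta))$.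
   Formalization: In (ii) the left endpoint c(B_1) is replaced by 0: the formula with unique η_y is proved for 0<y<c(0), and the value +∞ for y<0 or y>c(0), since the printed +∞ fails for 0≤y<c(B_1) when c(B_1)>0 (e.g. c(x)=1+|x-B_1|). *)

(* Defs.v *)
From HB Require Import structures.
From mathcomp Require Import all_boot all_order all_algebra.
From mathcomp Require Import complex.
From mathcomp Require Import all_classical all_reals all_analysis.

Set Implicit Arguments.
Unset Strict Implicit.
Unset Printing Implicit Defensive.

Import Order.TTheory GRing.Theory Num.Theory.
Import numFieldNormedType.Exports.

Local Open Scope classical_set_scope.
Local Open Scope ring_scope.
Local Open Scope complex_scope.

Section Triangle.
Variable R : realType.

(* The Euclidean norm as a real number: [`|x|] is valued in [R[i]] itself. *)
Definition dist (x y : R[i]) : R := Normc.normc (x - y).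

Definition lambda : R := 2 / Num.sqrt (3 * Num.sqrt 3).
Definition j : R[i] := cos (2 * pi / 3) +i* sin (2 * pi / 3).

Definition B2 : R[i] := lambda%:C * (0 +i* 1).
Definition B1 : R[i] := j ^+ 2 * B2.
Definition B3 : R[i] := j * B2.

Definition triangle : set R[i] :=
  [set x | exists a b d : R, [/\ 0 <= a, 0 <= b, 0 <= d, a + b + d = 1 &
     x = a%:C * B1 + b%:C * B2 + d%:C * B3]].

Definition D1 : set R[i] := [set (0 +i* 1) * j * t%:C | t in [set t : R | t < 0]].

Definition cell1 : set R[i] :=
  [set x | triangle x /\
     dist x B1 = Num.min (dist x B1) (Num.min (dist x B2) (dist x B3))] `\` D1.

(* [R[i]] carries no measurable structure in the library, so measurability and
   Lebesgue measure in the complex plane are those of [R * R]. *)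
Definition toC (p : R * R) : R[i] := p.1 +i* p.2.

Definition area_integral (D : set R[i]) (f : R[i] -> R) : R :=
  \int[(@lebesgue_measure R \x @lebesgue_measure R)%E]_(p in toC @^-1` D)
    f (toC p).

Definition measurable_on (D : set R[i]) (f : R[i] -> R) : Prop :=
  measurable_fun (toC @^-1` D) (f \o toC).

Definition continuous_on_at (D : set R[i]) (f : R[i] -> R) (x : R[i]) : Prop :=
  f y @[y --> within D (nbhs (x : (R[i] : numFieldType)))] --> f x.

Variable c : R[i] -> R.

Definition c1 (x : R[i]) : R := c x.
Definition c2 (x : R[i]) : R := c (j ^+ 2 * x).
Definition c3 (x : R[i]) : R := c (j * x).

Definition expI (theta : R) : R :=
  area_integral cell1 (fun x => expR (theta * c x)).
Definition cexpI (theta : R) : R :=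
  area_integral cell1 (fun x => c x * expR (theta * c x)).

Definition Lambda (theta : R) : R := ln (3 * expI theta).
(* Log-moment generating function of the variable equal to [c] on [cell1] and to
   [0] on the two other cells, of total area [2 / 3].  Because of this atom, its
   Legendre transform is [+oo] to the left of [0], and finite between [0] and
   [c B1] when [0 < c B1]. *)
Definition LambdaBar (theta : R) : R := ln (expI theta + 2 / 3).

End Triangle.

Arguments D1 R : clear implicits.
Arguments triangle R : clear implicits.
Arguments cell1 R : clear implicits.

Definition legendre (R : realType) (L : R -> R) (y : R) : \bar R :=
  ereal_sup [set (theta * y - L theta)%:E | theta in [set: R]].

(* Main.v *)
Require Import Defs.
From mathcomp Require Import all_boot all_order all_algebra.
From mathcomp Require Import complex.
From mathcomp Require Import all_classical all_reals all_analysis.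
From mathcomp Require Import measurable_realfun lra ring.
Import Order.TTheory GRing.Theory Num.Theory.
Import numFieldNormedType.Exports.
Local Open Scope classical_set_scope.
Local Open Scope ring_scope.
Local Open Scope complex_scope.

(** Both functions have the form [L t = ln (k * (E t + w))], where [E t] is the
    integral of [exp (t c)] over the cell and [w] is the mass of an atom at the
    cost [0]: [k = 3], [w = 0] for [Lambda], and [k = 1], [w = 2 / 3] for
    [LambdaBar].  Write [M t] for the tilted mean, that is the integral of
    [c exp (t c)] divided by [E t + w].

    Take [u = (b - a) (c - M a)] in [1 + u <= exp u] and integrate against the
    weight [exp (a c)], atom included: the linear term vanishes by the choice of
    [M a], and what remains is [L a + (b - a) * M a <= L b].  The inequality is
    strict for [a] different from [b] because [c] is not almost everywhere
    constant ([cgf_tangent_lt]).  So [M] plays the role of the derivative of [L],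
    it is strictly increasing, and the supremum that defines the transform at
    [y = M t] is attained at [t].

    It remains to find the range of [M].  If [M] stayed below some [y < c 0],
    the tangent inequality would put [L] below a line of slope [y] on the right;
    but for [y < s < c 0] the continuity of [c] at [0] gives a set of positive
    area where [c > s], which makes [L t] at least [t * s] up to a constant.  The
    same argument works on the left, with the continuity at [B1] when [w = 0];
    when [w > 0] the atom takes over and the lower end of the range is [0].  As
    [M] is continuous, it takes every value in between ([slope_onto]).  Beyond
    these ends, linear upper bounds on [L] make the transform infinite.  Inside,
    the maximisers attached to a compact interval are bounded, so the transform
    is locally Lipschitz ([legendre_continuous]).

    For the strict comparison, the inequality of arithmetic and geometric means
    for [3 E t], [1], [1] reads [Lambda t <= 3 * LambdaBar t].  With [t] the
    maximiser for [LambdaBar] at [y] and [v = y * t - LambdaBar t], it gives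
    [3 * y * t - Lambda t >= 3 * v], and [v > 0] since [y] exceeds the mean cost
    ([LambdaBar_lt_slope]); hence the transform of [Lambda] at [3 * y] is at
    least [3 * v > v].  This uses that the cell has area at most [1 / 3], which
    is computed in coordinates ([cell1P], [area_cell1_le]). *)

(** * Legendre transforms of strictly convex functions *)

Section LegendreTransform.
Context {R : realType}.

(** The tangent inequality makes [M] the derivative of the strictly convex [L]
    without any differentiation.  The growth bounds force the slopes to come
    arbitrarily close to [lo] and [hi]; the upper bounds make the transform
    infinite below [lo] and above [hi].  The growth bounds are required only for
    slopes strictly inside the range because [L] need not stay above a line
    whose slope is one of the ends. *)
Record slope_range (L M : R -> R) (lo hi : R) : Prop := SlopeRange {
  tangent_lt : forall a b, a != b -> L a + (b - a) * M a < L b;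
  slope_continuous : continuous M;
  growth_hi :
    forall s, s < hi -> exists K, forall t, 0 <= t -> t * s + K <= L t;
  growth_lo :
    forall s, lo < s -> exists K, forall t, t <= 0 -> t * s + K <= L t;
  upper_hi : exists K, forall t, 0 <= t -> L t <= t * hi + K;
  upper_lo : exists K, forall t, t <= 0 -> L t <= t * lo + K }.

Variables (L M : R -> R) (lo hi : R).
Hypothesis LM : slope_range L M lo hi.

Lemma tangent_le a b : L a + (b - a) * M a <= L b.
Proof.
have [->|ab] := eqVneq a b; first by rewrite subrr mul0r addr0.
exact/ltW/(tangent_lt _ _ _ _ LM).
Qed.

(** Add the tangent inequalities at the two points. *)
Lemma slope_mono a b : a < b -> M a < M b.
Proof.
move=> ab; have ba : 0 < b - a by rewrite subr_gt0.
rewrite -(ltr_pM2l ba).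
have := tangent_lt _ _ _ _ LM _ _ (negbT (lt_eqF ab)).
have := tangent_lt _ _ _ _ LM _ _ (negbT (gt_eqF ab)).
lra.
Qed.

Lemma slope_inj : injective M.
Proof.
move=> a b Mab; have [/slope_mono|/slope_mono|//] := ltgtP a b;
  by rewrite Mab ltxx.
Qed.

Lemma legendre_ge y t : ((y * t - L t)%:E <= legendre L y)%E.
Proof. by apply: ereal_sup_ubound; exists t => //; rewrite mulrC. Qed.

Lemma legendre_slope t : legendre L (M t) = (M t * t - L t)%:E.
Proof.
apply/eqP; rewrite eq_le legendre_ge andbT.
apply: ge_ereal_sup => _ [s _ <-]; rewrite lee_fin.
by have := tangent_le t s; lra.
Qed.

(** Otherwise the tangent at a large [t], read at [0], puts [L t] below
    [L 0 + t * y], while [L] grows with a slope [s > y]. *)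
Lemma slope_gt y : y < hi -> exists t, y < M t.
Proof.
move=> yhi; set s := (y + hi) / 2.
have [ys shi] : y < s /\ s < hi by rewrite /s; lra.
have [K HK] := growth_hi _ _ _ _ LM _ shi.
(* Large enough for [t * s + K <= L 0 + t * y] to fail. *)
pose t := (`|L 0| + `|K| + 1) / (s - y).
have t0 : 0 < t by rewrite divr_gt0 ?subr_gt0// ltr_wpDl// addr_ge0.
have tE : t * (s - y) = `|L 0| + `|K| + 1 by rewrite divfK// gt_eqF ?subr_gt0.
exists t; rewrite ltNge; apply/negP => Mty.
have := HK _ (ltW t0); have := tangent_le t 0.
have := ler_norm (L 0); have := ler_norm (- K); rewrite normrN.
have : t * M t <= t * y by rewrite ler_pM2l.
lra.
Qed.

Lemma slope_lt y : lo < y -> exists t, M t < y.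
Proof.
move=> loy; set s := (y + lo) / 2.
have [ys los] : s < y /\ lo < s by rewrite /s; lra.
have [K HK] := growth_lo _ _ _ _ LM _ los.
pose t := (`|L 0| + `|K| + 1) / (y - s).
have t0 : 0 < t by rewrite divr_gt0 ?subr_gt0// ltr_wpDl// addr_ge0.
have tE : t * (y - s) = `|L 0| + `|K| + 1 by rewrite divfK// gt_eqF ?subr_gt0.
exists (- t); rewrite ltNge; apply/negP => Mty.
have t0' : - t <= 0 by rewrite oppr_le0 ltW.
have := HK _ t0'; have := tangent_le (- t) 0.
have := ler_norm (L 0); have := ler_norm (- K); rewrite normrN.
have : t * y <= t * M (- t) by rewrite ler_pM2l.
lra.
Qed.

Lemma slope_onto y : lo < y -> y < hi -> exists t, M t = y.
Proof.
move=> /slope_lt[a Ma] /slope_gt[b Mb].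
have ab : a <= b.
  by rewrite leNgt; apply/negP => /slope_mono; lra.
have [||t _ Mt] := @IVT R M a b y ab; last by exists t.
- exact/continuous_subspaceT/(slope_continuous _ _ _ _ LM).
- by rewrite ge_min le_max (ltW Ma) (ltW Mb) orbT.
Qed.

(** The maximiser [t] at one point is a competitor at every other one, so the
    increments of the transform are at most [`|t|] times those of the argument;
    by monotonicity of [M] the maximisers over [`]a, b[] lie between those at
    [a] and [b]. *)
Lemma legendre_continuous y : lo < y -> y < hi ->
  {for y, continuous (legendre L)}.
Proof.
move=> loy yhi.
have [a [loa ay]] : exists a, lo < a /\ a < y by exists ((lo + y) / 2); lra.
have [b [yb bhi]] : exists b, y < b /\ b < hi by exists ((y + hi) / 2); lra.
have [ta Mta] := slope_onto _ loa (lt_trans ay yhi).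
have [tb Mtb] := slope_onto _ (lt_trans loy yb) bhi.
(* The summand 1 makes the Lipschitz constant positive, for the division. *)
set N := `|ta| + `|tb| + 1.
have N0 : 0 < N by rewrite ltr_wpDl// addr_ge0.
have inv z : a < z -> z < b -> exists2 t, M t = z & `|t| <= N.
  move=> az zb; have [t Mt] := slope_onto _ (lt_trans loa az) (lt_trans zb bhi).
  exists t => //.
  have : ta <= t by rewrite leNgt; apply/negP => /slope_mono; lra.
  have : t <= tb by rewrite leNgt; apply/negP => /slope_mono; lra.
  have := ler_norm tb; have := ler_norm (- ta); rewrite normrN.
  have := normr_ge0 ta; have := normr_ge0 tb.
  by rewrite ler_norml /N => *; apply/andP; split; lra.
have lip z w t : M t = z -> `|t| <= N -> a < w -> w < b ->
    fine (legendre L z) - fine (legendre L w) <= N * `|z - w|.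
  move=> Mt tN aw wb; have [u Mu uN] := inv w aw wb.
  rewrite -Mt -Mu !legendre_slope/= Mt Mu.
  have := tangent_le u t; rewrite Mu => tan.
  apply: (@le_trans _ _ ((z - w) * t)); first by lra.
  apply: le_trans (ler_norm _) _; rewrite normrM mulrC.
  by rewrite ler_wpM2r.
have [ty Mty _] := inv y ay yb.
rewrite /prop_for /continuous_at.
rewrite -[X in _ --> X](_ : (fine (legendre L y))%:E = _); last first.
  by rewrite -Mty legendre_slope.
have nab : \forall z \near y, a < z /\ z < b.
  have yab : y \in `]a, b[ by rewrite in_itv/= ay yb.
  have := near_in_itvoo yab; apply: filterS => z.
  by rewrite in_itv/= => /andP[].
apply/fine_cvgP; split.
  near=> z.
  have [az zb] : a < z /\ z < b by near: z.
  by have [t <- _] := inv z az zb; rewrite legendre_slope.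
apply/cvgrPdist_le => e e0; near=> z.
have [az zb] : a < z /\ z < b by near: z.
have yz : `|y - z| <= e / N.
  near: z; apply: (@cvgr_dist_le _ _ _ (nbhs y) _ id y) => //.
  by rewrite divr_gt0.
have {}yz : N * `|y - z| <= e by rewrite mulrC -ler_pdivlMr.
have [t Mt tN] := inv z az zb; have [s Ms sN] := inv y ay yb.
have l1 := lip _ _ _ Mt tN ay yb; have l2 := lip _ _ _ Ms sN az zb.
rewrite distrC in l1.
by rewrite /= ler_norml; apply/andP; split; lra.
Unshelve. all: by end_near. Qed.

Lemma legendre_gt y : hi < y -> legendre L y = +oo%E.
Proof.
have [K HK] := upper_hi _ _ _ _ LM; move=> hiy; apply/eqyP => A A0.
pose t := (`|K| + A) / (y - hi).
have t0 : 0 <= t by rewrite divr_ge0 ?subr_ge0 ?(ltW hiy)// addr_ge0// ltW.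
have tE : t * (y - hi) = `|K| + A by rewrite divfK// gt_eqF ?subr_gt0.
apply: le_trans (legendre_ge y t); rewrite lee_fin.
by have := HK t t0; have := ler_norm K; lra.
Qed.

Lemma legendre_lt y : y < lo -> legendre L y = +oo%E.
Proof.
have [K HK] := upper_lo _ _ _ _ LM; move=> ylo; apply/eqyP => A A0.
pose t := - ((`|K| + A) / (lo - y)).
have t0 : t <= 0.
  by rewrite oppr_le0 divr_ge0 ?subr_ge0 ?(ltW ylo)// addr_ge0// ltW.
have tE : t * (lo - y) = - (`|K| + A) by rewrite mulNr divfK// gt_eqF ?subr_gt0.
apply: le_trans (legendre_ge y t); rewrite lee_fin.
by have := HK t t0; have := ler_norm K; lra.
Qed.

Lemma slope_unique y : lo < y -> y < hi -> exists! t, M t = y.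
Proof.
move=> loy yhi; have [t Mt] := slope_onto _ loy yhi.
by exists t; split => // u Mu; apply: slope_inj; rewrite Mt Mu.
Qed.

Lemma legendre_eq y t : M t = y -> legendre L y = (y * t - L t)%:E.
Proof. by move=> <-; exact: legendre_slope. Qed.

Lemma legendre_out y : y < lo \/ hi < y -> legendre L y = +oo%E.
Proof. by case; [exact: legendre_lt|exact: legendre_gt]. Qed.

End LegendreTransform.

(** * Cumulant generating functions of a bounded function *)

Section TiltedIntegrals.
Context {d} {T : measurableType d} {R : realType}.
Variables (mu : {measure set T -> \bar R}) (D : set T) (f : T -> R).

Definition mgf (t : R) : R := \int[mu]_(x in D) expR (t * f x).
Definition tilted_moment (t : R) : R := \int[mu]_(x in D) (f x * expR (t * f x)).
(** The function [f] on [D], together with an atom of mass [w] where the value is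
    [0], has total mass [mu D + w]; the factor [k] is free so as to allow for
    its normalisation. *)
Definition cgf (k w t : R) : R := ln (k * (mgf t + w)).
Definition tilted_mean (w t : R) : R := tilted_moment t / (mgf t + w).

Variables (lo hi : R).
Hypothesis mD : measurable D.
Hypothesis D_fin : (mu D < +oo)%E.
Hypothesis mf : measurable_fun D f.
Hypothesis f_bnd : forall x, D x -> lo <= f x /\ f x <= hi.

(** All integrands below are continuous functions of [f], hence bounded, since
    [f] takes its values in a compact interval. *)
Lemma integrable_continuous_comp (g : R -> R) :
  continuous g -> mu.-integrable D (EFin \o (g \o f)).
Proof.
move=> cg; apply: measurable_bounded_integrable => //.
  apply: measurableT_comp => //; exact: continuous_measurable_fun.
have cK : compact (g @` `[lo, hi]).
  apply: continuous_compact; last exact: segment_compact.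
  exact: continuous_subspaceT.
have [N [Nr HN]] := @compact_bounded R R^o _ cK.
exists N; split => // m Nm x Dx.
apply: (HN _ Nm); exists (f x) => //=.
by have [? ?] := f_bnd _ Dx; rewrite in_itv/=; apply/andP.
Qed.

Lemma continuous_expM (t : R) : continuous (fun v : R => expR (t * v)).
Proof.
move=> v; apply: (@continuous_comp _ _ _ (fun v => t * v) expR).
  exact: mulrl_continuous.
exact: continuous_expR.
Qed.

Lemma continuous_id_expM (t : R) : continuous (fun v : R => v * expR (t * v)).
Proof. by move=> v; apply: cvgM => //; exact: continuous_expM. Qed.

Lemma integrable_exp t : mu.-integrable D (EFin \o (fun x => expR (t * f x))).
Proof. exact: (integrable_continuous_comp _ (continuous_expM t)). Qed.

Lemma integrable_id_exp t :
  mu.-integrable D (EFin \o (fun x => f x * expR (t * f x))).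
Proof. exact: (integrable_continuous_comp _ (continuous_id_expM t)). Qed.

(** Domination for [t] within distance 1 of [t0] by a function independent of
    [t]; taking [h] constant or the identity covers both moments. *)
Lemma continuous_integral_expM (h : R -> R) : continuous h ->
  continuous (fun t : R => \int[mu]_(x in D) (h (f x) * expR (t * f x))).
Proof.
move=> ch t0.
have ce t : continuous (fun v => h v * expR (t * v)).
  by move=> v; apply: cvgM; [exact: ch|exact: continuous_expM].
pose g (v : R) := `|h v| * expR ((`|t0| + 1) * `|v|).
have cg : continuous g.
  move=> v; apply: cvgM; first by apply: cvg_norm; exact: ch.
  apply: (@continuous_comp _ _ _ (fun v : R => `|v|)
    (fun v => expR ((`|t0| + 1) * v))).
    exact: norm_continuous.
  exact: continuous_expM.
apply: (@continuity_under_integral R d T mu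
  (fun t x => h (f x) * expR (t * f x)) D mD (t0 - 1) (t0 + 1) _ _ (g \o f)).
- by move=> t _; exact: (integrable_continuous_comp _ (ce t)).
- apply: aeW => x _ t _; apply: cvgM; first exact: cvg_cst.
  apply: (@continuous_comp R R R (fun t : R => t * f x) expR).
    exact: mulrr_continuous.
  exact: continuous_expR.
- exact: integrable_continuous_comp.
- move=> t; rewrite /= in_itv/= => /andP[t1 t2]; apply: aeW => x _.
  rewrite normrM ler_wpM2l// ger0_norm ?expR_ge0// ler_expR.
  apply: le_trans (ler_norm _) _; rewrite normrM ler_wpM2r//.
  have := ler_norm t0; have := ler_norm (- t0); rewrite normrN.
  by rewrite ler_norml => *; apply/andP; split; lra.
- by rewrite inE/= in_itv/=; apply/andP; split; lra.
Qed.

Lemma Rintegral_ge_measure (g : R -> R) (A : set T) (r : R) :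
  continuous g -> (forall x, D x -> 0 <= g (f x)) ->
  measurable A -> A `<=` D -> 0 <= r -> (forall x, A x -> r <= g (f x)) ->
  r * fine (mu A) <= \int[mu]_(x in D) g (f x).
Proof.
move=> cg g0 mA AD r0 rg.
have iD := integrable_continuous_comp _ cg.
have iA : mu.-integrable A (EFin \o (g \o f)) by exact: integrableS iD.
have A_fin : (mu A < +oo)%E.
  by apply: le_lt_trans D_fin; apply: le_measure; rewrite ?inE.
have fA : mu A \is a fin_num by rewrite ge0_fin_numE.
rewrite -[r]/(fine r%:E) -fineM//; apply: fine_le.
- by rewrite fin_numM.
- exact: integrable_fin_num.
rewrite -integral_cst//.
apply: (@le_trans _ _ (\int[mu]_(x in A) (g (f x))%:E)%E).
  apply: ge0_le_integral => //; exact: measurable_int iA.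
apply: ge0_subset_integral => //; exact: measurable_int iD.
Qed.

Lemma Rintegral_gt0 (g : R -> R) (A : set T) :
  continuous g -> (forall x, D x -> 0 <= g (f x)) ->
  measurable A -> A `<=` D -> (0 < mu A)%E -> (forall x, A x -> 0 < g (f x)) ->
  0 < \int[mu]_(x in D) g (f x).
Proof.
move=> cg g0 mA AD A0 gA.
have iD := integrable_continuous_comp _ cg.
rewrite lt_neqAle Rintegral_ge0// andbT; apply/eqP => I0.
have I0' : (\int[mu]_(x in D) `|(g (f x))%:E| = 0)%E.
  transitivity (\int[mu]_(x in D) (g (f x))%:E)%E.
    by apply: eq_integral => x /[!inE] Dx; rewrite gee0_abs// lee_fin g0.
  have IF : (\int[mu]_(x in D) (g (f x))%:E)%E \is a fin_num.
    exact: integrable_fin_num.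
  by rewrite -(fineK IF) -[0%E]/(0%:E) I0.
have [N [mN N0 DN]] : ae_eq mu D (fun x => (g (f x))%:E) (cst 0%E).
  apply/(ae_eq_integral_abs mu mD); last exact: I0'.
  exact: measurable_int iD.
suff : (mu A <= mu N)%E by rewrite N0 leNgt A0.
apply: le_measure; rewrite ?inE//.
apply: subset_trans DN => x Ax /= H.
by have [/eqP] := H (AD _ Ax); rewrite gt_eqF// gA.
Qed.

Hypothesis lo_ge0 : 0 <= lo.
Hypothesis lo_lt_hi : lo < hi.
(* These two say that [lo] and [hi] are the essential bounds of [f] on [D]. *)
Hypothesis near_hi : forall s, s < hi -> exists A,
  [/\ measurable A, A `<=` D, (0 < mu A)%E & forall x, A x -> s < f x].
Hypothesis near_lo : forall s, lo < s -> exists A,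
  [/\ measurable A, A `<=` D, (0 < mu A)%E & forall x, A x -> f x < s].

Lemma mgf_gt0 t : 0 < mgf t.
Proof.
have [A [mA AD A0 _]] := near_hi _ lo_lt_hi.
apply: (Rintegral_gt0 (fun v => expR (t * v)) A) => //.
- exact: continuous_expM.
- by move=> x _; rewrite expR_gt0.
Qed.

Lemma nonconstant m : exists A,
  [/\ measurable A, A `<=` D, (0 < mu A)%E & forall x, A x -> f x != m].
Proof.
have [mhi|him] := ltP m hi.
  have [A [mA AD A0 fA]] := near_hi _ mhi.
  by exists A; split => // x /fA; rewrite lt_neqAle eq_sym => /andP[].
have [A [mA AD A0 fA]] := near_lo _ (lt_le_trans lo_lt_hi him).
by exists A; split => // x /fA; rewrite lt_neqAle => /andP[].
Qed.

Variables (k w : R).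
Hypothesis k_gt0 : 0 < k.
Hypothesis w_ge0 : 0 <= w.

Lemma mgfD_gt0 t : 0 < mgf t + w.
Proof. by rewrite ltr_pwDl// mgf_gt0. Qed.

(** Integrate [1 + u < expR u] for [u = (b - a) * (f - m)], [m] the tilted mean at
    [a], against [expR (a * f)]: the mean of [u] under this weight, atom included,
    is zero. *)
Lemma cgf_tangent_lt a b : a != b ->
  cgf k w a + (b - a) * tilted_mean w a < cgf k w b.
Proof.
move=> ab; set m := tilted_mean w a; set t := b - a.
have t0 : t != 0 by rewrite subr_eq0 eq_sym.
have mE : tilted_moment a = m * (mgf a + w) by rewrite divfK// gt_eqF// mgfD_gt0.
pose g (v : R) := expR (b * v)
  - expR (t * m) * ((1 - t * m) * expR (a * v) + t * (v * expR (a * v))).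
have gE v : g v =
    expR (t * m) * expR (a * v) * (expR (t * (v - m)) - (1 + t * (v - m))).
  rewrite /g mulrBr -!expRD.
  have -> : t * m + a * v + t * (v - m) = b * v by rewrite /t; ring.
  by rewrite expRD; ring.
have cg : continuous g.
  move=> v; apply: cvgB; first exact: continuous_expM.
  apply: cvgM; first exact: cvg_cst.
  apply: cvgD; apply: cvgM; try exact: cvg_cst.
    exact: continuous_expM.
  exact: continuous_id_expM.
have [A [mA AD A0 fA]] := nonconstant m.
have : 0 < \int[mu]_(x in D) g (f x).
  apply: (Rintegral_gt0 g A) => //.
  - move=> x _; rewrite gE mulr_ge0 ?mulr_ge0 ?expR_ge0//.
    by rewrite subr_ge0 expR_ge1Dx.
  - move=> x Ax; rewrite gE mulr_gt0 ?mulr_gt0 ?expR_gt0//.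
    by rewrite subr_gt0 expR_gt1Dx// mulf_neq0// subr_eq0 fA.
have -> : \int[mu]_(x in D) g (f x) =
    mgf b - expR (t * m) * ((1 - t * m) * mgf a + t * tilted_moment a).
  have i1 := integrable_exp a; have i2 := integrable_id_exp a.
  have i3 := integrable_exp b.
  have iZ1 : mu.-integrable D (EFin \o (fun x => (1 - t * m) * expR (a * f x))).
    apply: (integrable_continuous_comp (fun v => (1 - t * m) * expR (a * v))).
    by move=> v; apply: cvgM; [exact: cvg_cst|exact: continuous_expM].
  have iZ2 : mu.-integrable D (EFin \o (fun x => t * (f x * expR (a * f x)))).
    apply: (integrable_continuous_comp (fun v => t * (v * expR (a * v)))).
    by move=> v; apply: cvgM; [exact: cvg_cst|exact: continuous_id_expM].
  have iS : mu.-integrable D (EFin \o (fun x =>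
      (1 - t * m) * expR (a * f x) + t * (f x * expR (a * f x)))).
    exact: (integrableD mD iZ1 iZ2).
  have iP : mu.-integrable D (EFin \o (fun x => expR (t * m) *
      ((1 - t * m) * expR (a * f x) + t * (f x * expR (a * f x))))).
    exact: (integrableZl mD (expR (t * m)) iS).
  by rewrite /g RintegralB// RintegralZl// RintegralD// !RintegralZl.
rewrite mE => I0.
(* The contribution of the atom, where [f] is replaced by [0]. *)
have wexp : w * (1 - t * m) * expR (t * m) <= w.
  rewrite -mulrA ler_piMr//.
  have /(ler_wpM2r (expR_ge0 (t * m))) := expR_ge1Dx (- (t * m)).
  by rewrite -expRD addNr expR0.
have key : expR (t * m) * (mgf a + w) < mgf b + w.
  have -> : expR (t * m) * (mgf a + w) =
     expR (t * m) * ((1 - t * m) * mgf a + t * (m * (mgf a + w)))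
     + w * (1 - t * m) * expR (t * m) by ring.
  by rewrite ltr_leD// -subr_gt0.
rewrite /cgf -[t * m]expRK -lnM ?posrE ?mulr_gt0 ?expR_gt0 ?mgfD_gt0//.
rewrite ltr_ln ?posrE ?mulr_gt0 ?expR_gt0 ?mgfD_gt0//.
by rewrite -mulrA ltr_pM2l// mulrC.
Qed.

Lemma tilted_mean_continuous : continuous (tilted_mean w).
Proof.
have c1 : continuous mgf.
  have -> : mgf = fun t => \int[mu]_(x in D) (1 * expR (t * f x)).
    by apply/funext => t; apply: eq_Rintegral => x _; rewrite mul1r.
  by apply: (continuous_integral_expM (fun=> 1)) => x; exact: cvg_cst.
have c2 : continuous tilted_moment.
  by apply: (continuous_integral_expM id) => x; exact: cvg_id.
move=> t; apply: cvgM; first exact: c2.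
apply: cvgV; first by rewrite gt_eqF// mgfD_gt0.
by apply: cvgD; [exact: c1|exact: cvg_cst].
Qed.

Lemma cgf_ge t s p : 0 < p -> p * expR (t * s) <= mgf t + w ->
  t * s + ln (k * p) <= cgf k w t.
Proof.
move=> p0 H; rewrite -[t * s]expRK -lnM ?posrE ?mulr_gt0 ?expR_gt0//.
rewrite ler_ln ?posrE ?mulr_gt0 ?expR_gt0 ?mgfD_gt0//.
by rewrite mulrCA ler_pM2l// [_ * p]mulrC.
Qed.

Lemma cgf_le t s p : 0 < p -> mgf t + w <= p * expR (t * s) ->
  cgf k w t <= t * s + ln (k * p).
Proof.
move=> p0 H; rewrite -[t * s]expRK -lnM ?posrE ?mulr_gt0 ?expR_gt0//.
rewrite ler_ln ?posrE ?mulr_gt0 ?expR_gt0 ?mgfD_gt0//.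
by rewrite mulrCA ler_pM2l// [_ * p]mulrC.
Qed.

Lemma mgf_ge (A : set T) t s : measurable A -> A `<=` D ->
  (forall x, A x -> t * s <= t * f x) -> fine (mu A) * expR (t * s) <= mgf t.
Proof.
move=> mA AD sf; rewrite mulrC.
apply: (Rintegral_ge_measure (fun v => expR (t * v))) => //.
- exact: continuous_expM.
- by move=> x Ax; rewrite ler_expR sf.
Qed.

Lemma mgf_le t s : (forall x, D x -> t * f x <= t * s) ->
  mgf t <= fine (mu D) * expR (t * s).
Proof.
move=> sf; rewrite mulrC -Rintegral_cst//; apply: le_Rintegral => //.
- exact: integrable_exp.
- apply: (integrable_continuous_comp (fun=> expR (t * s))) => v; exact: cvg_cst.
- by move=> x Dx; rewrite ler_expR sf.
Qed.

Lemma fine_measure_gt0 A : measurable A -> A `<=` D -> (0 < mu A)%E ->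
  0 < fine (mu A).
Proof.
move=> mA AD A0; rewrite fine_gt0// A0/=.
by apply: le_lt_trans D_fin; apply: le_measure; rewrite ?inE.
Qed.

Lemma cgf_growth_hi s : s < hi ->
  exists K, forall t, 0 <= t -> t * s + K <= cgf k w t.
Proof.
move=> /near_hi[A [mA AD A0 fA]]; exists (ln (k * fine (mu A))) => t t0.
apply: cgf_ge; first exact: fine_measure_gt0.
rewrite ler_wpDr// mgf_ge// => x Ax.
by rewrite ler_wpM2l// ltW// fA.
Qed.

Lemma cgf_growth_lo s : lo < s ->
  exists K, forall t, t <= 0 -> t * s + K <= cgf k w t.
Proof.
move=> /near_lo[A [mA AD A0 fA]]; exists (ln (k * fine (mu A))) => t t0.
apply: cgf_ge; first exact: fine_measure_gt0.
rewrite ler_wpDr// mgf_ge// => x Ax.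
by rewrite ler_wnM2l// ltW// fA.
Qed.

(** The atom alone keeps the generating function away from zero. *)
Lemma cgf_growth_atom s : 0 < w -> 0 < s ->
  exists K, forall t, t <= 0 -> t * s + K <= cgf k w t.
Proof.
move=> w0 s0; exists (ln (k * w)) => t t0; apply: cgf_ge => //.
apply: (@le_trans _ _ w); last by rewrite ler_wpDl// ltW// mgf_gt0.
rewrite ler_piMr// -expR0 ler_expR.
by rewrite mulr_le0_ge0// ltW.
Qed.

Lemma domain_measure_gt0 : 0 < fine (mu D).
Proof.
have [A [mA AD A0 _]] := near_hi _ lo_lt_hi.
apply: fine_measure_gt0 => //; apply: lt_le_trans A0 _.
by apply: le_measure; rewrite ?inE.
Qed.

Lemma cgf_upper_hi : exists K, forall t, 0 <= t -> cgf k w t <= t * hi + K.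
Proof.
exists (ln (k * (fine (mu D) + w))) => t t0.
apply: cgf_le; first by rewrite ltr_pwDl// domain_measure_gt0.
rewrite mulrDl lerD//.
  by apply: mgf_le => x Dx; rewrite ler_wpM2l//; case: (f_bnd _ Dx).
rewrite ler_peMr// -expR0 ler_expR mulr_ge0//.
by rewrite (le_trans lo_ge0)// ltW.
Qed.

Lemma cgf_upper_lo : w = 0 ->
  exists K, forall t, t <= 0 -> cgf k w t <= t * lo + K.
Proof.
move=> w0; exists (ln (k * fine (mu D))) => t t0.
apply: cgf_le; first exact: domain_measure_gt0.
rewrite w0 addr0.
by apply: mgf_le => x Dx; rewrite ler_wnM2l//; case: (f_bnd _ Dx).
Qed.

Lemma cgf_upper_atom : exists K, forall t, t <= 0 -> cgf k w t <= t * 0 + K.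
Proof.
exists (ln (k * (fine (mu D) + w))) => t t0.
apply: cgf_le; first by rewrite ltr_pwDl// domain_measure_gt0.
rewrite mulr0 expR0 mulr1 lerD2r -[fine _]mulr1 -expR0 -(mulr0 t).
apply: mgf_le => x Dx; rewrite ler_wnM2l//.
by case: (f_bnd _ Dx) => + _; apply: le_trans.
Qed.

Lemma cgf_slope_range : w = 0 ->
  slope_range (cgf k w) (tilted_mean w) lo hi.
Proof.
move=> w0; split.
- exact: cgf_tangent_lt.
- exact: tilted_mean_continuous.
- exact: cgf_growth_hi.
- exact: cgf_growth_lo.
- exact: cgf_upper_hi.
- exact: cgf_upper_lo.
Qed.

Lemma cgf_atom_slope_range : 0 < w ->
  slope_range (cgf k w) (tilted_mean w) 0 hi.
Proof.
move=> w0; split.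
- exact: cgf_tangent_lt.
- exact: tilted_mean_continuous.
- exact: cgf_growth_hi.
- by move=> s; exact: cgf_growth_atom.
- exact: cgf_upper_hi.
- exact: cgf_upper_atom.
Qed.

End TiltedIntegrals.

(** * Areas in the plane *)

Section PlaneAreas.
Context {R : realType}.

Definition area := [the {measure set _ -> \bar R} of
  (@lebesgue_measure R \x @lebesgue_measure R)%E].

Lemma measurable_halfplane (u v t : R) :
  measurable [set q : R * R | u * q.1 + v * q.2 <= t].
Proof.
rewrite -[X in measurable X]setTI; apply: measurable_fun_le => //.
apply: measurable_funD.
  exact: (measurable_funM (measurable_cst u) measurable_fst).
exact: (measurable_funM (measurable_cst v) measurable_snd).
Qed.

Lemma integral_affine (a b k m : R) : a < b ->
  (\int[@lebesgue_measure R]_(x in `[a, b]) (k * x + m)%:E =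
   ((b - a) * (k * (a + b) / 2 + m))%:E)%E.
Proof.
move=> ab; pose F (x : R) := k / 2 * x ^+ 2 + m * x.
have dF x : is_derive x (1 : R) F (k * x + m).
  rewrite /F; apply: is_derive_eq.
  by rewrite /GRing.scale/=; field.
have cF : continuous F.
  move=> x; apply: differentiable_continuous; apply/derivable1_diffP.
  by case: (dF x).
rewrite (@continuous_FTC2 _ (fun x => k * x + m) F)//.
- by rewrite -EFinB /F; congr (_%:E); field.
- apply: continuous_subspaceT => x; apply: cvgD; last exact: cvg_cst.
  exact: mulrl_continuous.
- split; first by move=> x _; case: (dF x).
  + exact: cvg_at_right_filter (cF a).
  + exact: cvg_at_left_filter (cF b).
- by move=> x _; rewrite derive1E derive_val.
Qed.

Definition trapezoid (a b p k m : R) : set (R * R) :=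
  [set q | [/\ a <= q.1, q.1 <= b, p <= q.2 & q.2 <= k * q.1 + m]].

Lemma area_trapezoid (a b p k m : R) : a < b ->
  p <= k * a + m -> p <= k * b + m ->
  area (trapezoid a b p k m) = ((b - a) * (k * (a + b) / 2 + (m - p)))%:E.
Proof.
move=> ab pa pb; rewrite -integral_affine// [RHS]integral_mkcond.
rewrite /area/= /product_measure1; apply: eq_integral => x _ /=.
rewrite patchE; case: ifPn => [|xab].
  rewrite inE/= in_itv/= => /andP[ax xb].
  have -> : xsection (trapezoid a b p k m) x = `[p, k * x + m]%classic.
    apply/seteqP; split => y; rewrite /xsection/= inE in_itv/=.
      by move=> -[/= _ _ -> ->].
    by move=> /andP[py yk]; split.
  rewrite lebesgue_measure_itv/= lte_fin; case: ltP => kp.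
    by rewrite -EFinB addrA.
  have : p <= k * x + m by nra.
  by move=> pk; congr (_%:E); lra.
have -> : xsection (trapezoid a b p k m) x = set0.
  apply/seteqP; split => y //; rewrite /xsection/= inE => -[/= ax xb _ _].
  by move: xab; rewrite notin_setE/= in_itv/= ax xb; apply.
exact: measure0.
Qed.

Lemma measurable_trapezoid (a b p k m : R) : measurable (trapezoid a b p k m).
Proof.
have -> : trapezoid a b p k m =
    [set q | (-1) * q.1 + 0 * q.2 <= - a] `&` [set q | 1 * q.1 + 0 * q.2 <= b]
    `&` ([set q | 0 * q.1 + (-1) * q.2 <= - p]
    `&` [set q | - k * q.1 + 1 * q.2 <= m]).
  apply/seteqP; split => q /=.
    by case=> *; do !split; lra.
  by move=> [[? ?] [? ?]]; split; lra.
by apply: measurableI; apply: measurableI; exact: measurable_halfplane.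
Qed.

Lemma area_box_gt0 (a b p q : R) : a < b -> p < q ->
  (0 < area (`]a, b[ `*` `]p, q[))%E.
Proof.
move=> ab pq; rewrite /area/= product_measure1E//.
have itv_gt0 (c e : R) : c < e ->
    (0 < lebesgue_measure (`]c, e[%classic : set R))%E.
  move=> ce; rewrite lebesgue_measure_itv/= lte_fin ce -EFinB.
  by rewrite lte_fin subr_gt0.
by apply: mule_gt0; exact: itv_gt0.
Qed.

End PlaneAreas.

(** * The cell in coordinates *)

Section KiteCell.
Context {R : realType}.
Notation s3 := (Num.sqrt (3 : R)).
Notation l := (@lambda R).

Lemma sqrt3_gt0 : 0 < s3. Proof. by rewrite sqrtr_gt0. Qed.

Lemma sqr_sqrt3 : s3 * s3 = 3.
Proof. by rewrite -expr2 sqr_sqrtr. Qed.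

Lemma lambda_gt0 : 0 < l.
Proof. by rewrite /lambda divr_gt0// sqrtr_gt0 mulr_gt0// sqrt3_gt0. Qed.

Lemma sqr_lambda : l * l * s3 * 3 = 4.
Proof.
have h : (0 : R) < 3 * s3 by rewrite mulr_gt0// sqrt3_gt0.
rewrite -expr2 /lambda expr_div_n sqr_sqrtr ?(ltW h)//.
by field; rewrite gt_eqF// sqrt3_gt0.
Qed.

(** With [a = pi / 3], [sin (2 a) = sin (pi - a) = sin a] forces
    [cos a = 1 / 2]. *)
Lemma jE : @j R = (- (1 / 2)) +i* (s3 / 2).
Proof.
have sa : 0 < sin (pi / 3 : R).
  by apply: sin_gt0_pi; have := pi_gt0 R; move=> ?; apply/andP; split; lra.
have e1 : 2 * pi / 3 = (pi / 3) *+ 2 :> R by rewrite mulr2n; field.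
have e2 : 2 * pi / 3 = pi - pi / 3 :> R by field.
have h1 : sin (2 * pi / 3) = sin (pi / 3 : R).
  by rewrite e2 sinB sinpi cospi; ring.
have c12 : cos (pi / 3 : R) = 1 / 2.
  apply: (mulIf (negbT (gt_eqF sa))).
  move: h1; rewrite e1 sin_mulr2n mulr2n; lra.
have sE : sin (pi / 3 : R) = s3 / 2.
  have s2 : 0 <= s3 / 2 by rewrite divr_ge0// ltW// sqrt3_gt0.
  apply/eqP; rewrite -(@eqrXn2 _ 2)// ?(ltW sa)//.
  by rewrite sin2cos2 c12 !expr_div_n sqr_sqrtr//; apply/eqP; field.
rewrite /j h1 sE; congr (_ +i* _).
by rewrite e1 cos_mulr2n c12 mulr2n; field.
Qed.

Lemma B2E : B2 R = 0 +i* l.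
Proof. by rewrite /B2 /=; simpc. Qed.

Lemma B3E : B3 R = (- (l * s3 / 2)) +i* (- (l / 2)).
Proof. by rewrite /B3 B2E jE; simpc; congr (_ +i* _); field. Qed.

Lemma B1E : B1 R = (l * s3 / 2) +i* (- (l / 2)).
Proof.
rewrite /B1 expr2 -mulrA -/(B3 R) B3E jE; simpc; have := sqr_sqrt3 => ss.
by congr (_ +i* _); field: ss.
Qed.

(** The barycentric coordinates of a point are affine in its cartesian ones, and
    the three inequalities say that they are nonnegative. *)
Lemma triangleP (x y : R) : triangle R (x +i* y) <->
  [/\ - (l / 2) <= y, s3 * x + y <= l & - s3 * x + y <= l].
Proof.
have s0 := sqrt3_gt0; have ss := sqr_sqrt3; have l0 := lambda_gt0.
rewrite /triangle/= B1E B2E B3E; split.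
  move=> [a [b [d [a0 b0 d0 abd]]]]; simpc => -[-> ->].
  have [la lb ld] : [/\ 0 <= l * a, 0 <= l * b & 0 <= l * d].
    by split; rewrite mulr_ge0// ltW.
  have -> : s3 * (a * (l * s3 / 2) - d * (l * s3 / 2)) =
    3 / 2 * (l * a - l * d) by field: ss.
  have ll : l = l * a + l * b + l * d by rewrite -!mulrDr abd mulr1.
  by split; lra.
move=> [h1 h2 h3].
exists ((l + s3 * x - y) / (3 * l)), ((2 * y + l) / (3 * l)),
  ((l - s3 * x - y) / (3 * l)); split.
- by rewrite divr_ge0//; lra.
- by rewrite divr_ge0//; lra.
- by rewrite divr_ge0//; lra.
- by field; rewrite gt_eqF.
- simpc; congr (_ +i* _); last by field; rewrite gt_eqF.
  by field: ss; rewrite gt_eqF.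
Qed.

Lemma dist_le (x y u v u' v' : R) :
  (dist (x +i* y) (u +i* v) <= dist (x +i* y) (u' +i* v')) =
  ((x - u) ^+ 2 + (y - v) ^+ 2 <= (x - u') ^+ 2 + (y - v') ^+ 2).
Proof. by rewrite /dist /= ler_sqrt// addr_ge0// sqr_ge0. Qed.

(** The cell is the kite with vertices [0], [B1] and the midpoints of the two
    sides through [B1], deprived of its edge from [0] to the midpoint of
    [B1 B2], except for the vertex [0]. *)
Lemma cell1P (x y : R) : cell1 R (x +i* y) <->
  [/\ - (l / 2) <= y, 0 <= x, s3 * y <= x & s3 * x + y <= l] /\
  ~ (0 < x /\ x = s3 * y).
Proof.
have s0 := sqrt3_gt0; have ss := sqr_sqrt3; have l0 := lambda_gt0.
have dE : dist (x +i* y) (B1 R) =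
    Num.min (dist (x +i* y) (B1 R))
      (Num.min (dist (x +i* y) (B2 R)) (dist (x +i* y) (B3 R)))
    <-> s3 * y <= x /\ 0 <= x.
  have -> : (s3 * y <= x) = (dist (x +i* y) (B1 R) <= dist (x +i* y) (B2 R)).
    rewrite B1E B2E dist_le -subr_ge0 -[RHS]subr_ge0.
    rewrite [X in _ = (_ <= X)](_ : _ = l * s3 * (x - s3 * y)).
      by rewrite pmulr_rge0// mulr_gt0.
    by field: ss.
  have -> : (0 <= x) = (dist (x +i* y) (B1 R) <= dist (x +i* y) (B3 R)).
    rewrite B1E B3E dist_le -[RHS]subr_ge0.
    rewrite [X in _ = (_ <= X)](_ : _ = 2 * l * s3 * x); last by field: ss.
    by rewrite pmulr_rge0// !mulr_gt0.
  split=> [e|[h1 h2]].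
    by split; rewrite e ?ge_min lexx ?orbT.
  by rewrite min_l// le_min h1 h2.
have DE : D1 R (x +i* y) <-> 0 < x /\ x = s3 * y.
  rewrite /D1/= jE; split.
    by move=> [t /= t0]; simpc => -[<- <-]; split; nra.
  move=> [x0 xE]; exists (- (2 * y)) => /=.
    by move: x0; rewrite xE pmulr_rgt0//; lra.
  by simpc; rewrite xE; congr (_ +i* _); field.
rewrite /cell1/=; split.
  move=> [[/triangleP[h1 h2 _] /dE[h3 h4]] nD].
  by split => // h; apply: nD; apply/DE.
move=> [[h1 h2 h3 h4] nD]; split; last by move=> /DE.
split; last by apply/dE.
by apply/triangleP; split => //; nra.
Qed.

End KiteCell.

(** * Area and small neighbourhoods in the cell *)

Section CellNeighbourhoods.
Context {R : realType}.
Notation s3 := (Num.sqrt (3 : R)).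
Notation l := (@lambda R).
Notation cell := (@toC R @^-1` cell1 R).

Lemma measurable_triangle : measurable (@toC R @^-1` triangle R).
Proof.
have -> : @toC R @^-1` triangle R =
    [set q | 0 * q.1 + (-1) * q.2 <= l / 2] `&`
    ([set q | s3 * q.1 + 1 * q.2 <= l] `&` [set q | - s3 * q.1 + 1 * q.2 <= l]).
  apply/seteqP; split => -[x y] /=; rewrite /toC/=.
    by move=> /triangleP[? ? ?]; do !split; lra.
  by move=> [? [? ?]]; apply/triangleP; split; lra.
by apply: measurableI; [|apply: measurableI]; exact: measurable_halfplane.
Qed.

Lemma measurable_cell1 : measurable cell.
Proof.
have -> : cell =
    ([set q | 0 * q.1 + (-1) * q.2 <= l / 2]
      `&` [set q | (-1) * q.1 + 0 * q.2 <= 0]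
    `&` ([set q | (-1) * q.1 + s3 * q.2 <= 0]
      `&` [set q | s3 * q.1 + 1 * q.2 <= l]))
    `\` (~` [set q | 1 * q.1 + 0 * q.2 <= 0]
      `&` [set q | 1 * q.1 + (- s3) * q.2 <= 0]).
  apply/seteqP; split => -[x y] /=; rewrite /toC/=.
    move=> /cell1P[[h1 h2 h3 h4] nD]; split; first by do !split; lra.
    by move=> [/negP x0 h]; apply: nD; split; lra.
  move=> [[[h1 h2] [h3 h4]] nD]; apply/cell1P; split; first by split; lra.
  by move=> [x0 xE]; apply: nD; split; [apply/negP; lra|lra].
apply: measurableD.
  by do 2 apply: measurableI; exact: measurable_halfplane.
by apply: measurableI; [apply: measurableC|]; exact: measurable_halfplane.
Qed.

Lemma cell1_triangle : cell1 R `<=` triangle R.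
Proof. by move=> x [[]]. Qed.

(** The vertical line through the midpoint of [B1 B2], at abscissa [l * s3 / 4],
    cuts the kite into a trapezoid and a triangle, both standing on the line
    [y = - l / 2]. *)
Lemma area_cell1_le : (area cell <= (3^-1)%:E)%E.
Proof.
have s0 := @sqrt3_gt0 R; have ss := @sqr_sqrt3 R; have l0 := @lambda_gt0 R.
have ll := @sqr_lambda R.
pose T1 := trapezoid 0 (l * s3 / 4) (- (l / 2)) (s3 / 3) 0.
pose T2 := trapezoid (l * s3 / 4) (l * s3 / 2) (- (l / 2)) (- s3) l.
have ls : 0 < l * s3 by rewrite mulr_gt0.
have lss : l * s3 * s3 = 3 * l by ring: ss.
have a1 : area T1 = (5 * (l * l * s3) / 32)%:E.
  rewrite area_trapezoid; first (congr (_%:E); by field: ss); lra.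
have a2 : area T2 = (3 * (l * l * s3) / 32)%:E.
  rewrite area_trapezoid; first (congr (_%:E); by field: ss); lra.
have -> : (3^-1)%:E = (area T1 + area T2)%E.
  by rewrite a1 a2 -EFinD; congr (_%:E); lra.
apply: (@le_trans _ _ (area (T1 `|` T2))).
  apply: le_measure; rewrite ?inE; first exact: measurable_cell1.
    by apply: measurableU; exact: measurable_trapezoid.
  move=> [x y]; rewrite /toC/= => /cell1P[[h1 h2 h3 h4] _].
  have h3' : y <= s3 / 3 * x.
    by rewrite -(ler_pM2l s0) (_ : s3 * (s3 / 3 * x) = x)//; field: ss.
  have [xl|xl] := leP x (l * s3 / 4); [left|right].
    by split => //=; rewrite addr0.
  split => //=; first exact: ltW.
    by rewrite -(ler_pM2l s0); lra.
  by rewrite mulNr; lra.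
by apply: measureU2; exact: measurable_trapezoid.
Qed.

Lemma dist_lt (x y u v e : R) : 0 < e -> (x - u) ^+ 2 + (y - v) ^+ 2 < e ^+ 2 ->
  dist (x +i* y) (u +i* v) < e.
Proof.
move=> e0 h; rewrite /dist/= -[ltRHS]ger0_norm ?(ltW e0)// -sqrtr_sqr.
by rewrite ltr_sqrt// exprn_gt0.
Qed.

Lemma sqrt3_itv : 1 < s3 /\ s3 < 2.
Proof. by have := @sqrt3_gt0 R; have := @sqr_sqrt3 R => *; split; nra. Qed.

(** A small box just below and to the right of [0], and one just above and to the
    left of [B1], lie in the cell. *)
Lemma cell1_near_vertex (z : R[i]) (e : R) : z = 0 \/ z = B1 R -> 0 < e ->
  exists A, [/\ measurable A, A `<=` cell, (0 < area A)%E &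
    forall q, A q -> dist (toC q) z < e].
Proof.
move=> zE e0; have s0 := @sqrt3_gt0 R; have l0 := @lambda_gt0 R.
have [s1 s2] := sqrt3_itv.
(* [4 r <= l] keeps the boxes in the triangle, [4 r <= e] keeps them near [z]. *)
pose r := Num.min e l / 4.
have r0 : 0 < r by rewrite divr_gt0// lt_min e0.
have [re rl] : 4 * r <= e /\ 4 * r <= l.
  by rewrite /r mulrC divfK//; split; rewrite ge_min lexx ?orbT.
have rs : r < s3 * r by rewrite ltr_pMl.
have ls : l < l * s3 by rewrite ltr_pMr.
have ss := @sqr_sqrt3 R.
have sq (t p : R) : - p < t -> t < p -> t ^+ 2 < p ^+ 2.
  move=> h1 h2; rewrite -real_normK ?num_real//.
  by rewrite ltrXn2r ?ltr_norml ?h1//; lra.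
have re2 : r ^+ 2 + (2 * r) ^+ 2 < e ^+ 2.
  by have : (4 * r) ^+ 2 <= e ^+ 2 by [rewrite lerXn2r ?nnegrE//; lra]; nra.
case: zE => ->.
  have -> : (0 : R[i]) = 0 +i* 0 by [].
  exists (`]0, r[ `*` `](- r), 0[); split.
  - exact: measurableX.
  - move=> [x y] /=; rewrite !in_itv/= => -[/andP[x1 x2] /andP[y1 y2]].
    have sx : s3 * x < s3 * r by rewrite ltr_pM2l.
    have sy : s3 * y < 0 by rewrite pmulr_rlt0.
    have sr : s3 * r < 2 * r by rewrite ltr_pM2r.
    by rewrite /toC/=; apply/cell1P; split; [split; lra|lra].
  - by apply: area_box_gt0; lra.
  - move=> [x y] /=; rewrite !in_itv/= => -[/andP[x1 x2] /andP[y1 y2]].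
    apply: dist_lt => //; apply: lt_trans re2.
    by apply: ltrD; apply: sq => /=; lra.
rewrite B1E.
(* The horizontal offset from [B1] is at least the vertical one, so the box stays
   under the side [B1 B2], of slope [- s3]. *)
exists (`](l * s3 / 2 - 2 * r), (l * s3 / 2 - r)[
  `*` `](- (l / 2)), (- (l / 2) + r)[).
split.
- exact: measurableX.
- move=> [x y] /=; rewrite !in_itv/= => -[/andP[x1 x2] /andP[y1 y2]].
  have sx : s3 * x < s3 * (l * s3 / 2 - r) by rewrite ltr_pM2l.
  have sE : s3 * (l * s3 / 2 - r) = 3 * l / 2 - s3 * r by field: ss.
  have sy : s3 * y < 0 by rewrite pmulr_rlt0//; lra.
  by rewrite /toC/=; apply/cell1P; split; [split; lra|lra].
- by apply: area_box_gt0; lra.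
- move=> [x y] /=; rewrite !in_itv/= => -[/andP[x1 x2] /andP[y1 y2]].
  apply: dist_lt => //; apply: lt_trans re2.
  by rewrite addrC; apply: ltrD; apply: sq => /=; lra.
Qed.

(** Radii in the topology of [R[i]] are elements of [R[i]]; being positive, they
    are real. *)
Lemma continuous_on_at_dist (D : set R[i]) (c : R[i] -> R) (z : R[i]) (e : R) :
  continuous_on_at D c z -> 0 < e ->
  exists2 r, 0 < r & forall x, D x -> dist x z < r -> `|c z - c x| < e.
Proof.
move=> /cvgrPdist_lt cz /cz.
rewrite /within/= => /nbhs_ballP[r /= r0 H].
move: r0; rewrite ltcE/= => /andP[/eqP rI rR].
exists (complex.Re r) => // x Dx xz; apply: H => //.
rewrite /ball/= normc_def ltcE/= rI eqxx/=.
move: xz; rewrite /dist; case: x {Dx} => x1 x2; case: z {cz} => z1 z2 /=.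
by rewrite -[(z1 - x1) ^+ 2]sqrrN opprB -[(z2 - x2) ^+ 2]sqrrN opprB.
Qed.

End CellNeighbourhoods.

(** * The cost on the cell *)

Section CostOnCell.
Context {R : realType}.
Notation cell := (@toC R @^-1` cell1 R).
Variable c : R[i] -> R.
Hypothesis c_ge0 : forall x, triangle R x -> 0 <= c x.
Hypothesis c_meas : measurable_on (triangle R) c.
Hypothesis c_between : forall x, cell1 R x -> x <> 0 -> x <> B1 R ->
  c (B1 R) < c x /\ c x < c 0.
Hypothesis c_cont : continuous_on_at (triangle R) c 0 /\
  continuous_on_at (triangle R) c (B1 R).

Lemma expIE : expI c = mgf area cell (c \o @toC R).
Proof. by []. Qed.

Lemma LambdaE : Lambda c = cgf area cell (c \o @toC R) 3 0.
Proof. by apply/funext => t; rewrite /cgf addr0. Qed.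

Lemma LambdaBarE : LambdaBar c = cgf area cell (c \o @toC R) 1 (2 / 3).
Proof. by apply/funext => t; rewrite /cgf mul1r. Qed.

Lemma cost_B1_lt_0 : c (B1 R) < c 0.
Proof.
have l0 := @lambda_gt0 R; have s0 := @sqrt3_gt0 R; have [s1 s2] := @sqrt3_itv R.
have : cell1 R (lambda R / 2 +i* 0).
  apply/cell1P; rewrite mulr0; split; last by lra.
  by split; nra.
move=> /c_between[]; first by case; lra.
  by rewrite B1E => -[]; lra.
exact: lt_trans.
Qed.

Lemma cost_B1_ge0 : 0 <= c (B1 R).
Proof.
have l0 := @lambda_gt0 R; have ss := @sqr_sqrt3 R.
apply: c_ge0; rewrite B1E; apply/triangleP.
have -> : - Num.sqrt 3 * (lambda R * Num.sqrt 3 / 2) = - (3 / 2 * lambda R).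
  by field: ss.
have -> : Num.sqrt 3 * (lambda R * Num.sqrt 3 / 2) = 3 / 2 * lambda R.
  by field: ss.
by split; lra.
Qed.

Lemma cost_bounds q : cell q ->
  c (B1 R) <= (c \o @toC R) q /\ (c \o @toC R) q <= c 0.
Proof.
move=> cq /=; have lt := cost_B1_lt_0.
have [->|q0] := pselect (toC q = 0); first by rewrite lexx ltW.
have [->|q1] := pselect (toC q = B1 R); first by rewrite lexx ltW.
by have [? ?] := c_between _ cq q0 q1; rewrite !ltW.
Qed.

Lemma cell_fin : (area cell < +oo)%E.
Proof. by apply: le_lt_trans (area_cell1_le) _; rewrite ltry. Qed.

Lemma measurable_cost : measurable_fun cell (c \o @toC R).
Proof.
apply: measurable_funS c_meas; first exact: measurable_triangle.
by move=> q; exact: cell1_triangle.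
Qed.

Lemma cost_near (z : R[i]) (e : R) : z = 0 \/ z = B1 R -> 0 < e -> exists A,
  [/\ measurable A, A `<=` cell, (0 < area A)%E &
    forall q, A q -> `|c z - c (toC q)| < e].
Proof.
move=> zE e0; have cz : continuous_on_at (triangle R) c z.
  by case: zE => ->; case: c_cont.
have [r r0 H] := continuous_on_at_dist _ _ _ _ cz e0.
have [A [mA AD A0 Ar]] := cell1_near_vertex _ _ zE r0.
exists A; split => // q Aq; apply: H; last exact: Ar.
exact/cell1_triangle/AD.
Qed.

Lemma cost_near_hi s : s < c 0 -> exists A,
  [/\ measurable A, A `<=` cell, (0 < area A)%E &
    forall q, A q -> s < (c \o @toC R) q].
Proof.
rewrite -subr_gt0 => sc.
have [A [mA AD A0 Ac]] := cost_near _ _ (or_introl erefl) sc.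
by exists A; split => // q /Ac; rewrite ltr_norml => /andP[_]/=; lra.
Qed.

Lemma cost_near_lo s : c (B1 R) < s -> exists A,
  [/\ measurable A, A `<=` cell, (0 < area A)%E &
    forall q, A q -> (c \o @toC R) q < s].
Proof.
rewrite -subr_gt0 => sc.
have [A [mA AD A0 Ac]] := cost_near _ _ (or_intror erefl) sc.
by exists A; split => // q /Ac; rewrite ltr_norml => /andP[+ _]/=; lra.
Qed.

Lemma Lambda_slope_range :
  slope_range (Lambda c) (fun t => cexpI c t / expI c t) (c (B1 R)) (c 0).
Proof.
have -> : (fun t => cexpI c t / expI c t) =
    tilted_mean area cell (c \o @toC R) 0.
  by apply/funext => t; rewrite /tilted_mean addr0.
rewrite LambdaE; apply: cgf_slope_range => //.
- exact: measurable_cell1.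
- exact: cell_fin.
- exact: measurable_cost.
- exact: cost_bounds.
- exact: cost_B1_ge0.
- exact: cost_B1_lt_0.
- exact: cost_near_hi.
- exact: cost_near_lo.
Qed.

Lemma LambdaBar_slope_range :
  slope_range (LambdaBar c) (fun t => cexpI c t / (expI c t + 2 / 3)) 0 (c 0).
Proof.
rewrite LambdaBarE; apply: (cgf_atom_slope_range _ _ _ (c (B1 R))) => //.
- exact: measurable_cell1.
- exact: cell_fin.
- exact: measurable_cost.
- exact: cost_bounds.
- exact: cost_B1_ge0.
- exact: cost_B1_lt_0.
- exact: cost_near_hi.
- exact: cost_near_lo.
Qed.

Lemma expI_gt0 t : 0 < expI c t.
Proof.
rewrite expIE; apply: (mgf_gt0 _ _ _ (c (B1 R)) (c 0)) => //.
- exact: measurable_cell1.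
- exact: cell_fin.
- exact: measurable_cost.
- exact: cost_bounds.
- exact: cost_B1_lt_0.
- exact: cost_near_hi.
Qed.

Lemma expI0_le : expI c 0 <= 3^-1.
Proof.
have -> : expI c 0 = \int[area]_(q in cell) 1.
  by apply: eq_Rintegral => q _; rewrite mul0r expR0.
rewrite Rintegral_cst; last exact: measurable_cell1.
rewrite mul1r -lee_fin fineK ?area_cell1_le// ge0_fin_numE//.
exact: cell_fin.
Qed.

Lemma cexpI0 : cexpI c 0 = area_integral (cell1 R) c.
Proof. by apply: eq_Rintegral => q _; rewrite mul0r expR0 mulr1. Qed.

Lemma area_integral_cost_ge0 : 0 <= area_integral (cell1 R) c.
Proof. by apply: Rintegral_ge0 => q cq; exact/c_ge0/cell1_triangle. Qed.

(** This is the inequality of arithmetic and geometric means,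
    [3 E <= (E + 2 / 3) ^ 3], where the difference of the two sides is
    [(E - 1 / 3) ^ 2 * (E + 8 / 3)]. *)
Lemma Lambda_le_LambdaBar t : Lambda c t <= 3 * LambdaBar c t.
Proof.
have E0 := expI_gt0 t; set E := expI c t in E0 *.
have E2 : 0 < E + 2 / 3 by lra.
rewrite /Lambda /LambdaBar -/E [leRHS]mulr_natl -lnXn//.
rewrite ler_ln ?posrE ?exprn_gt0 ?mulr_gt0// -subr_ge0.
have -> : (E + 2 / 3) ^+ 3 - 3 * E = (E - 1 / 3) ^+ 2 * (E + 8 / 3) by field.
by rewrite mulr_ge0 ?sqr_ge0//; lra.
Qed.

(** In other words, the transform of [LambdaBar] is positive above the mean cost.
    Its value is at least [- LambdaBar c 0 >= 0], as the cell has area at most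
    [1 / 3], and the tangent inequality makes this strict unless [t = 0].  In
    that case an area of exactly [1 / 3] would make the tilted mean equal to the
    mean, so the area is smaller and [LambdaBar c 0 < 0]. *)
Lemma LambdaBar_lt_slope t :
  area_integral (cell1 R) c < cexpI c t / (expI c t + 2 / 3) ->
  LambdaBar c t < cexpI c t / (expI c t + 2 / 3) * t.
Proof.
set y := _ / _ => gy.
have E0 := expI0_le; have E0' := expI_gt0 0.
have [t0|t0] := eqVneq t 0; last first.
  have := tangent_lt _ _ _ _ LambdaBar_slope_range _ _ t0; rewrite -/y.
  have : LambdaBar c 0 <= 0 by apply: ln_le0; lra.
  lra.
rewrite t0 mulr0; apply: ln_lt0; apply/andP; split; first by lra.
rewrite lt_neqAle; apply/andP; split; last by lra.
apply/eqP => E1; move: gy.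
by rewrite /y t0 E1 divr1 cexpI0 ltxx.
Qed.

End CostOnCell.

Theorem proposition1p4 (R : realType) (c : R[i] -> R)
  (c_ge0 : forall x, triangle R x -> 0 <= c x)
  (c_meas : measurable_on (triangle R) c)
  (c_bdd : has_ubound [set c x | x in triangle R])
  (Ha : forall x, triangle R x ->
    (dist x (B1 R) < dist x (B2 R) -> c1 c x < c2 c x) /\
    (dist x (B1 R) < dist x (B3 R) -> c1 c x < c3 c x))
  (Hb : forall x, cell1 R x -> x <> 0 -> x <> B1 R ->
    c (B1 R) < c x /\ c x < c 0)
  (Hc : continuous_on_at (triangle R) c 0 /\
        continuous_on_at (triangle R) c (B1 R)) :
  let gamma := area_integral (cell1 R) c in
  let Lstar := legendre (Lambda c) in
  let Lbarstar := legendre (LambdaBar c) in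
  ({within [set` `]c (B1 R), c 0[], continuous Lstar} /\
   {within [set` `]c (B1 R), c 0[], continuous Lbarstar}) /\
  (* (i) *)
  ((forall y : R, c (B1 R) < y -> y < c 0 ->
      (exists! theta : R, cexpI c theta / expI c theta = y) /\
      (forall theta : R, cexpI c theta / expI c theta = y ->
         Lstar y = (y * theta - Lambda c theta)%:E)) /\
   (forall y : R, y < c (B1 R) \/ c 0 < y -> Lstar y = +oo%E)) /\
  (* (ii) with left endpoint 0 : see LambdaBar *)
  ((forall y : R, 0 < y -> y < c 0 ->
      (exists! eta : R, cexpI c eta / (expI c eta + 2 / 3) = y) /\
      (forall eta : R, cexpI c eta / (expI c eta + 2 / 3) = y ->
         Lbarstar y = (y * eta - LambdaBar c eta)%:E)) /\
   (forall y : R, y < 0 \/ c 0 < y -> Lbarstar y = +oo%E)) /\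
  (* (iii) *)
  (forall y : R, gamma < y -> y < c 0 / 3 -> (Lbarstar y < Lstar (3 * y)%R)%E).
Proof.
move=> gamma Lstar Lbarstar.
have LS := @Lambda_slope_range R c c_ge0 c_meas Hb Hc.
have BS := @LambdaBar_slope_range R c c_ge0 c_meas Hb Hc.
have lo0 := @cost_B1_ge0 R c c_ge0.
have g0 := @area_integral_cost_ge0 R c c_ge0.
split; [split|split; [|split]].
- apply: continuous_in_subspaceT => y; rewrite inE/= in_itv/= => /andP[y1 y2].
  exact: (legendre_continuous _ _ _ _ LS).
- apply: continuous_in_subspaceT => y; rewrite inE/= in_itv/= => /andP[y1 y2].
  by apply: (legendre_continuous _ _ _ _ BS) => //; exact: le_lt_trans y1.
- split=> [y y1 y2|y]; last exact: (legendre_out _ _ _ _ LS).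
  split; first exact: (slope_unique _ _ _ _ LS).
  by move=> t; exact: (legendre_eq _ _ _ _ LS).
- split=> [y y1 y2|y]; last exact: (legendre_out _ _ _ _ BS).
  split; first exact: (slope_unique _ _ _ _ BS).
  by move=> t; exact: (legendre_eq _ _ _ _ BS).
move=> y gy y3.
have [y0 yhi] : 0 < y /\ y < c 0 by rewrite /gamma in gy; lra.
have [t [ty _]] := slope_unique _ _ _ _ BS _ y0 yhi.
rewrite /Lbarstar (legendre_eq _ _ _ _ BS _ _ ty).
(* The maximiser [t] for the transform with atom at [y] is used as a competitor
   for the transform without atom at [3 * y]. *)
apply: lt_le_trans (legendre_ge _ _ t); rewrite lte_fin.
have := @Lambda_le_LambdaBar R c c_meas Hb Hc t.
have := @LambdaBar_lt_slope R c c_ge0 c_meas Hb Hc t; rewrite ty => /(_ gy).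
lra.
Qed.
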